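(* Let $p\in(1,+\infty)$. Suppose that the system is $T$-periodic for some $T>0$ and that the operator $U(T,0)^*$ has an eigenvalue whose modulus is equal to its spectral radius $e^{\omega_0T}$. Let $\omega<\omega_0$. Then there is no $N_\omega\in\mathbb N$ such that $$\left\|\left(P_{0,T|\mathrm{Im}\,\Pi_0}\right)^N\right\|\le e^{\omega NT}\qquad\forall N\ge N_\omega$$ (operator norm on $\mathrm{Im}\,\Pi_0$ equipped with the norm of $L^p(X,\mu_0)$), and there is no $C_{T,\omega}>0$ such that $$\left\|P_{s,t}f-\int_Xf(y)\,\mu_t(dy)\right\|_{L^p(X,\mu_s)}\le C_{T,\omega}\,e^{\omega(t-s)}\,\|f\|_{L^p(X,\mu_t)}\qquad\forall s<t,\ f\in L^p(X,\mu_t).$$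
   Context: $X$ is a separable real Hilbert space with inner product $\langle\cdot,\cdot\rangle_X$ and norm $|\cdot|_X$; $\mathcal L(X)$ is the space of bounded linear operators on $X$. $\{A(t)\}_{t\in\mathbb R}$ is a family of linear operators $A(t):D(A(t))\subseteq X\to X$ generating a strongly continuous evolution operator $\{U(t,s):s\le t\}\subseteq\mathcal L(X)$, i.e. $\partial_tU(t,s)=A(t)U(t,s)$ for $s<t$, $U(t,s)=U(t,r)U(r,s)$ for $s\le r\le t$, $U(\tau,\tau)=I$, and $(t,s)\mapsto U(t,s)x$ is continuous on $\{s\le t\}$ for every $x\in X$. The set $\Omega_U:=\{\omega\in\mathbb R:\exists M>0,\ \|U(t,s)\|_{\mathcal L(X)}\le Me^{\omega(t-s)}\ \forall s\le t\}$ is non-empty and $\omega_0:=\inf\Omega_U<0$. $\{B(t)\}_{t\in\mathbb R}\subseteq\mathcal L(X)$ is bounded in operator norm and $t\mapsto B(t)x$ is measurable for every $x\in X$. For $s\le t$ set $Q(t,s):=\int_s^tU(t,r)B(r)B(r)^*U(t,r)^*\,dr$ and $Q(t,-\infty):=\int_{-\infty}^tU(t,r)B(r)B(r)^*U(t,r)^*\,dr$. Standing assumptions: every $Q(t,s)$ is trace class and $\sup_{s\le t}\mathrm{tr}\,Q(t,s)<+\infty$ for every $t$ (which implies that $Q(t,-\infty)$ is trace class); controllability: $\mathrm{Im}\,U(t,s)\subseteq \mathrm{Im}\,Q(t,s)^{1/2}$ for all $s<t$; the measures $\mu_t$ below are non-degenerate. $\mathcal N(a,Q)$ denotes the Gaussian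 measure on $X$ with mean $a$ and covariance $Q$; $\mu_t:=\mathcal N(0,Q(t,-\infty))$. The Ornstein-Uhlenbeck operators are $[P_{s,t}\varphi](x):=\int_X\varphi(U(t,s)x+y)\,\mathcal N(0,Q(t,s))(dy)$ for $\varphi\in C_b(X)$ (bounded continuous functions), $s\le t$. Each $P_{s,t}$ with $s<t$ extends uniquely to a contraction $L^p(X,\mu_t)\to L^p(X,\mu_s)$, still denoted $P_{s,t}$. $T$-periodic means: $A(t+T)=A(t)$ and $B(t+T)=B(t)$ for all $t\in\mathbb R$; consequently $U(t+T,s+T)=U(t,s)$ and $Q(t+T,s+T)=Q(t,s)$ for $s\le t$, and $\mu_{t+T}=\mu_t$. Under periodicity the spectral radius of $U(T,0)$ and of $U(T,0)^*$ is $e^{\omega_0T}$. $\Pi_t:L^p(X,\mu_t)\to L^p(X,\mu_t)$ is the projection $\Pi_tf:=f-\int_Xf\,d\mu_t$, so $\mathrm{Im}\,\Pi_t$ is the closed subspace of functions with zero $\mu_t$-mean; under periodicity $P_{0,T}$ maps $\mathrm{Im}\,\Pi_0$ into itself. Spectral notions for operators on real spaces refer to their complexifications. *)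

(* Defs.v *)
From mathcomp Require Import all_boot all_order all_algebra.
From mathcomp Require Import sesquilinear complex.
From mathcomp Require Import all_classical all_reals all_analysis.

Set Implicit Arguments.
Unset Strict Implicit.
Unset Printing Implicit Defensive.

Import Order.TTheory GRing.Theory Num.Theory.
Import numFieldNormedType.Exports.

Local Open Scope classical_set_scope.
Local Open Scope ring_scope.

Notation borel X := (g_sigma_algebraType (@open X)).

Section Hilbert.
Context {R : realType} {X : completeNormedModType R}.
Variable ip : {dot X for idfun}.

Definition hilbert_norm := forall x : X, `|x| ^+ 2 = ip x x.

Definition separable := exists2 S : set X, countable S & dense S.

Definition bounded_linear (T : X -> X) := linear T /\ continuous T.

Definition opnorm (T : X -> X) : R := sup [set `|T x| | x in [set x | `|x| <= 1]].

(* The adjoint of a bounded linear T, which is unique and exists by the Riesz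
   representation theorem; 0 is only a default value. *)
Definition adjoint (T : X -> X) (y : X) : X :=
  xget 0 [set z | forall x, ip (T x) y = ip x z].

Definition positive_op (Q : X -> X) :=
  [/\ bounded_linear Q, forall x y, ip (Q x) y = ip x (Q y)
    & forall x, 0 <= ip (Q x) x].

(* The positive square root, unique whenever Q is positive. *)
Definition sqrt_op (Q : X -> X) : X -> X :=
  xget (idfun : X -> X) [set S | positive_op S /\ forall x, S (S x) = Q x].

Definition orthonormal_basis (E : set X) :=
  [/\ {in E, forall e, ip e e = 1},
      {in E &, forall e f, e <> f -> ip e f = 0}
    & forall x, {in E, forall e, ip x e = 0} -> x = 0].

Definition basis : set X := xget set0 orthonormal_basis.

(* The trace of a positive operator; it does not depend on the basis. *)
Definition trace (Q : X -> X) : \bar R :=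
  (\esum_(e in basis) (ip (Q e) e)%:E)%E.

(* For positive operators, trace class means finite trace. *)
Definition positive_trace_class (Q : X -> X) :=
  positive_op Q /\ (trace Q < +oo)%E.

(* The X-valued integral of F over D for the Lebesgue measure, in the weak
   sense.  Since X is separable, this is the Bochner integral whenever |F| is
   integrable over D. *)
Definition is_integral (D : set R) (F : R -> X) (z : X) := forall y : X,
  lebesgue_measure.-integrable D (fun r => (ip (F r) y)%:E) /\
  ip z y = \int[lebesgue_measure]_(r in D) ip (F r) y.

Definition integral_X (D : set R) (F : R -> X) : X := xget 0 (is_integral D F).

(* The one-dimensional Gaussian law with mean m and variance v; normal_prob m 0
   is not the Dirac mass, hence the case distinction. *)
Definition gaussian1 (m v : R) (S : set R) : \bar R :=
  if v == 0 then \d_m S else normal_prob m (Num.sqrt v) S.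

Definition is_gaussian (mu : probability (borel X) R) (a : X) (Q : X -> X) :=
  forall (h : X) (S : set R), measurable S ->
    mu [set x : borel X | S (ip x h)] = gaussian1 (ip a h) (ip (Q h) h) S.

(* N is a realisation of the notation N(a, Q).  Such an N exists, and its values
   on the pairs (a, Q) below are uniquely determined. *)
Definition gaussian_notation
    (N : X -> (X -> X) -> probability (borel X) R) :=
  forall a Q, positive_trace_class Q -> is_gaussian (N a Q) a Q.

(* X * X is the complexification of X: (x, y) stands for x + iy. *)
Definition cscale (l : R[i]) (h : X * X) : X * X :=
  (complex.Re l *: h.1 - complex.Im l *: h.2,
   complex.Im l *: h.1 + complex.Re l *: h.2).

Definition complexify (T : X -> X) (h : X * X) : X * X := (T h.1, T h.2).

Definition ceigenvalue (T : X -> X) (l : R[i]) :=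
  exists2 h : X * X, h <> 0 & complexify T h = cscale l h.

Definition spectrum (T : X -> X) : set R[i] := [set l | ~ exists S : X * X -> X * X,
  [/\ continuous S, cancel (fun h => complexify T h - cscale l h) S
    & cancel S (fun h => complexify T h - cscale l h)]].

Definition spectral_radius (T : X -> X) : R :=
  sup [set ComplexField.Normc.normc l | l in spectrum T].

Definition evolution_operator (U : R -> R -> X -> X) :=
  [/\ forall t s, s <= t -> bounded_linear (U t s),
      forall t r s x, s <= r -> r <= t -> U t s x = U t r (U r s x),
      forall t x, U t t x = x
    & forall x, {within [set ts : R * R | ts.2 <= ts.1],
        continuous (fun ts : R * R => U ts.1 ts.2 x)}].

(* A t, with domain DA t, is an unbounded operator; the values of A t outside
   DA t are irrelevant. *)
Definition linear_operator_on (DA : set X) (A : X -> X) :=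
  DA 0 /\ forall (k : R) x y, DA x -> DA y ->
    DA (k *: x + y) /\ A (k *: x + y) = k *: A x + A y.

Definition generates (DA : R -> set X) (A : R -> X -> X)
    (U : R -> R -> X -> X) :=
  forall t s x, s < t -> DA t (U t s x) /\
    is_derive t 1 (fun r : R => U r s x) (A t (U t s x)).

Definition growth_exponents (U : R -> R -> X -> X) : set R :=
  [set w | exists2 M : R, 0 < M &
    forall t s, s <= t -> opnorm (U t s) <= M * expR (w * (t - s))].

(* If growth_exponents U is not bounded below, inf returns 0 instead of -oo, so
   growth_bound U < 0 excludes that case; no w lies below -oo anyway. *)
Definition growth_bound (U : R -> R -> X -> X) : R := inf (growth_exponents U).

Definition covariance_integrand (U : R -> R -> X -> X) (B : R -> X -> X)
    (t : R) (x : X) (r : R) : X :=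
  U t r (B r (adjoint (B r) (adjoint (U t r) x))).

Definition Qts (U : R -> R -> X -> X) (B : R -> X -> X) (t s : R) (x : X) : X :=
  integral_X `[s, t] (covariance_integrand U B t x).

Definition Qinf (U : R -> R -> X -> X) (B : R -> X -> X) (t : R) (x : X) : X :=
  integral_X `]-oo, t] (covariance_integrand U B t x).

(* U is periodic too: A and B periodic imply it as soon as the evolution
   operator generated by A is unique. *)
Definition periodic_system (DA : R -> set X) (A : R -> X -> X)
    (U : R -> R -> X -> X) (B : R -> X -> X) (T : R) :=
  [/\ forall t, DA (t + T) = DA t,
      forall t x, DA t x -> A (t + T) x = A t x,
      forall t x, B (t + T) x = B t x
    & forall t s x, s <= t -> U (t + T) (s + T) x = U t s x].

Definition ou (N : X -> (X -> X) -> probability (borel X) R)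
    (U : R -> R -> X -> X) (B : R -> X -> X) (s t : R)
    (phi : borel X -> R) (x : borel X) : R :=
  \int[N 0 (Qts U B t s)]_(y in [set: borel X]) phi (U t s x + y).

(* Elements of L^p are represented by functions in Lfun, and P acts on
   representatives; equality in L^p is equality almost everywhere. *)
Definition is_Lp_extension (p : R) (mus mut : probability (borel X) R)
    (P0 P : (borel X -> R) -> (borel X -> R)) :=
  [/\ {in Lfun mut p%:E, forall f, P f \in Lfun mus p%:E},
      {in Lfun mut p%:E &, forall f g (k : R),
        ae_eq mus setT (P (fun x => k * f x + g x)) (fun x => k * P f x + P g x)},
      {in Lfun mut p%:E, forall f,
        ('N[mus]_(p%:E)[EFin \o P f] <= 'N[mut]_(p%:E)[EFin \o f])%E}
    & forall phi : borel X -> R, continuous (phi : X -> R) ->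
        (exists K : R, forall x, `|phi x| <= K) -> ae_eq mus setT (P phi) (P0 phi)].

Definition centering (mu : probability (borel X) R) (f : borel X -> R) :
    borel X -> R :=
  fun x => f x - \int[mu]_(y in [set: borel X]) f y.

Definition centered (p : R) (mu : probability (borel X) R) : set (borel X -> R) :=
  [set centering mu f | f in [set f | f \in Lfun mu p%:E]].

(* The norm of the restriction of S to the subspace V of L^p(mu). *)
Definition Lp_opnorm (p : R) (mu : probability (borel X) R)
    (V : set (borel X -> R)) (S : (borel X -> R) -> (borel X -> R)) : \bar R :=
  ereal_sup [set 'N[mu]_(p%:E)[EFin \o S f]%E |
    f in [set f | V f /\ ('N[mu]_(p%:E)[EFin \o f] <= 1)%E]].

End Hilbert.

(* Main.v *)
Require Import Defs.
From HB Require Import structures.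
From mathcomp Require Import all_boot all_order all_algebra.
From mathcomp Require Import sesquilinear complex ring lra.
From mathcomp Require Import all_classical all_reals all_analysis.
From mathcomp Require Import measurable_realfun.
Import Order.TTheory GRing.Theory Num.Theory.
Import numFieldNormedType.Exports.
Local Open Scope classical_set_scope.
Local Open Scope ring_scope.

Set Implicit Arguments.
Unset Strict Implicit.
Unset Printing Implicit Defensive.

(** An Ornstein-Uhlenbeck operator acts on linear functionals through the
adjoint of the evolution operator: since the measure that it averages against
is centred, [P_{s,t} <., h> = <., U(t,s)^* h>]
([Lp_extension_linear_functional]).  Under periodicity both [P_{0,T}^n] and
[P_{0,nT}] therefore send [<., h>] to [<., V^n h>], where [V = U(T,0)^*], and
these functionals have zero mean, so they lie in the subspace on which decay is
claimed.

Let [h1 + i h2] be an eigenvector of [V] for an eigenvalue of modulus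
[rho = exp(omega_0 T)].  On the span of [h1] and [h2] the map [V^n] is [rho^n]
times a rotation.  The function [s(h)], the [L^p(mu_0)] norm of [<., h>], is a
norm on [X], because [mu_0] is non-degenerate.  If [s(V^n h) <= e s(h)] for
every [h], inverting the rotation gives [rho^n <= 2 e] ([rotation_growth]).  A
decay rate [omega < omega_0] would make [e = C exp(omega n T)], and then
[exp((omega_0 - omega) n T)] would remain bounded ([no_faster_decay]).

The analytic work lies in three places.
- Linear functionals are unbounded, so [P_{s,t}] is known on them only by
  density.  Truncation at height [k] changes [u] by at most [u^2 / k]; hence the
  truncated functionals converge in [L^p], with an explicit rate, and so do
  their images.  This requires all moments of one-dimensional projections, which
  follow from [E exp(u) < oo] for a Gaussian [u].
- [mu_t] has to be known to be Gaussian, which requires [Q(t,-oo)] to be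
  positive and of trace class.  The weak integral that defines [Q(t,-oo) x]
  exists because [Q(t,-oo) x] would otherwise be the default value [0], against
  non-degeneracy.  It is symmetric, hence bounded (Hellinger-Toeplitz), and each
  finite partial sum of its trace is the limit, as [s -> -oo], of the same
  partial sum for [Q(t,s)] ([le_trace_half_line]).
- [mu_{t+T} = mu_t] follows from translation invariance of Lebesgue measure
  ([Qinf_periodic]). *)

(** * Hilbert spaces: Riesz representation and adjoints *)

Lemma nonneg_quadratic_discriminant {R : realFieldType} (a b c : R) : 0 <= a ->
  (forall t, 0 <= t ^+ 2 * a + 2 * t * b + c) -> b ^+ 2 <= a * c.
Proof.
rewrite le_eqVlt => /predU1P[<-|a0] H.
  have [->|b0] := eqVneq b 0; first by rewrite expr0n mul0r.
  have := H (- (c + 1) / (2 * b)).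
  have -> : (- (c + 1) / (2 * b)) ^+ 2 * 0 + 2 * (- (c + 1) / (2 * b)) * b + c
    = -1 by field.
  by rewrite ler0N1.
have := H (- b / a).
have -> : (- b / a) ^+ 2 * a + 2 * (- b / a) * b + c = (a * c - b ^+ 2) / a.
  by field; rewrite gt_eqF.
by rewrite pmulr_lge0 ?invr_gt0// subr_ge0.
Qed.

Section PositiveForms.
Context {R : realType} {X : lmodType R}.
Variable q : X -> X -> R.
Hypothesis qC : forall x y, q x y = q y x.
Hypothesis qP : forall k x y z, q (k *: x + y) z = k * q x z + q y z.
Hypothesis q_ge0 : forall x, 0 <= q x x.

(** [q(t x + y, t x + y)] is a non-negative quadratic polynomial in [t]. *)
Lemma positive_form_cauchy_schwarz x y : q x y ^+ 2 <= q x x * q y y.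
Proof.
apply: nonneg_quadratic_discriminant => // t.
have -> : t ^+ 2 * q x x + 2 * t * q x y + q y y = q (t *: x + y) (t *: x + y).
  by rewrite qP (qC x (_ + _)) (qC y (_ + _)) !qP (qC y x); ring.
exact: q_ge0.
Qed.

End PositiveForms.

Section LinearMaps.
Context {R : realFieldType} {X : lmodType R}.
Variable V : X -> X.
Hypothesis Vlin : linear V.

Lemma linear_map0 : V 0 = 0.
Proof. by have := Vlin (-1) 0 0; rewrite scaler0 addr0 scaleN1r addNr. Qed.

Lemma linear_mapZ c u : V (c *: u) = c *: V u.
Proof. by have := Vlin c u 0; rewrite linear_map0 !addr0. Qed.

Lemma iter_linear_mapZ n c u : iter n V (c *: u) = c *: iter n V u.
Proof. by elim: n => //= n ->; exact: linear_mapZ. Qed.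

End LinearMaps.

Section HilbertSpace.
Context {R : realType} {X : completeNormedModType R}.
Variable ip : {dot X for idfun}.
Hypothesis hip : hilbert_norm ip.

Lemma ipC x y : ip x y = ip y x.
Proof. by have := @hermitian_subproof _ _ false idfun ip x y; rewrite expr0 mul1r. Qed.

Lemma ipP k x y z : ip (k *: x + y) z = k * ip x z + ip y z.
Proof. by rewrite linearDl linearZl_LR. Qed.

Lemma ip0l y : ip 0 y = 0. Proof. exact: linear0l. Qed.
Lemma ipDl x y z : ip (x + y) z = ip x z + ip y z. Proof. exact: linearDl. Qed.
Lemma ipZl k x y : ip (k *: x) y = k * ip x y.
Proof. exact: linearZl_LR. Qed.
Lemma ipNl x y : ip (- x) y = - ip x y. Proof. exact: linearNl. Qed.
Lemma ipDr x y z : ip z (x + y) = ip z x + ip z y.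
Proof. by rewrite !(ipC z) ipDl. Qed.
Lemma ipZr k x y : ip y (k *: x) = k * ip y x.
Proof. by rewrite !(ipC y) ipZl. Qed.
Lemma ipNr x y : ip y (- x) = - ip y x.
Proof. by rewrite !(ipC y) ipNl. Qed.

Lemma ip_injr x y : (forall z, ip z x = ip z y) -> x = y.
Proof.
move=> E; apply/eqP; rewrite -subr_eq0 -normr_eq0 -sqrf_eq0 hip.
by rewrite ipDr ipNr E subrr.
Qed.

Lemma ip_injl x y : (forall z, ip x z = ip y z) -> x = y.
Proof. by move=> E; apply: ip_injr => z; rewrite ipC E ipC. Qed.

Lemma cauchy_schwarz x y : `|ip x y| <= `|x| * `|y|.
Proof.
rewrite -(@ler_pXn2r _ 2)// ?nnegrE ?mulr_ge0// real_normK ?num_real//.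
rewrite exprMn !hip; apply: positive_form_cauchy_schwarz.
- exact: ipC.
- exact: ipP.
- by move=> z; rewrite -hip sqr_ge0.
Qed.

Lemma continuous_ipl y : continuous (fun x => ip x y).
Proof.
move=> x; apply/cvgrPdist_le => e e0.
have y0 : 0 < `|y| + 1 by rewrite ltr_wpDl.
have d0 : 0 < e / (`|y| + 1) by exact: divr_gt0.
near=> z.
rewrite -ipNl -ipDl (le_trans (cauchy_schwarz _ _))//.
rewrite (@le_trans _ _ (`|x - z| * (`|y| + 1)))//.
  by rewrite ler_wpM2l// lerDl.
rewrite -ler_pdivlMr//; near: z.
Unshelve. all: by end_near. Qed.

Lemma bounded_functional (f : X -> R) : linear f -> continuous f ->
  exists2 C, 0 < C & forall x, `|f x| <= C * `|x|.
Proof.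
move=> lf cf.
pose g : {linear X -> R^o} := HB.pack f (GRing.isLinear.Build R X R^o _ f lf).
have /linear_bounded_continuous/linear_boundedP : continuous g by [].
move=> [M [Mr H]]; exists (`|M| + 1); first by rewrite ltr_wpDl.
by apply: H; rewrite (le_lt_trans (ler_norm M))// ltrDl.
Qed.

(** The representing vector minimises [J x = |x|^2 - 2 f x].  Near-minimisers are
close to each other by the parallelogram law, so a minimising sequence [u]
converges; varying [J] along a line through a near-minimiser shows that
[<u n, h>] is close to [f h]. *)
Lemma riesz_representation (f : X -> R) : linear f ->
  (exists C, forall x, `|f x| <= C * `|x|) ->
  exists z, forall x, f x = ip x z.
Proof.
move=> lf [C fC].
have fZ k x : f (k *: x) = k * f x.
  have f0 : f 0 = 0.
    by have := fC 0; rewrite normr0 mulr0 normr_le0 => /eqP.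
  by have := lf k x 0; rewrite !addr0 f0 addr0.
have fD x y : f (x + y) = f x + f y by have := lf 1 x y; rewrite !scale1r.
pose J x := `|x| ^+ 2 - 2 * f x.
have J_lb x : - C ^+ 2 <= J x.
  have := fC x; have := ler_norm (f x); rewrite /J.
  by set u := `|x|; have := sqr_ge0 (u - C); nra.
pose m := inf (range J).
have has_infJ : has_inf (range J).
  by split; [exists (J 0), 0|exists (- C ^+ 2) => _ [x _ <-]].
have mJ x : m <= J x by apply: ge_inf; [exact: has_infJ.2|exists x].
(* The quadratic [t |-> J (x + t h) - m] is non-negative. *)
have Jvar x h e : J x <= m + e -> (ip x h - f h) ^+ 2 <= `|h| ^+ 2 * e.
  move=> Je; apply: nonneg_quadratic_discriminant => [|t]; first exact: sqr_ge0.
  have := mJ (t *: h + x).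
  rewrite /J !hip in Je *; rewrite fD fZ !(ipDl,ipDr,ipZl,ipZr) (ipC h x).
  by move=> ?; lra.
(* Parallelogram law at the midpoint of [x] and [y]. *)
have Jnear x y e d : J x <= m + e -> J y <= m + d ->
    `|x - y| ^+ 2 <= 2 * e + 2 * d.
  move=> Jx Jy; have := mJ (2^-1 *: (x + y)).
  rewrite /J !hip in Jx Jy *; rewrite fZ fD.
  rewrite !(ipDl,ipDr,ipZl,ipZr,ipNl,ipNr) (ipC y x).
  by move=> ?; lra.
have /boolp.choice[u uE] : forall n, exists x, J x <= m + n.+1%:R^-1.
  move=> n; have n0 : 0 < n.+1%:R^-1 :> R by rewrite invr_gt0.
  by have [_ [x _ <-] /ltW xm] := inf_adherent n0 has_infJ; exists x.
have u_lim z : (fun n => ip (u n) z) @ \oo --> f z.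
  apply/cvgrPdist_le => e e0; near=> n.
  rewrite distrC -(@ler_pXn2r _ 2)// ?nnegrE ?(ltW e0)//.
  rewrite real_normK ?num_real// (le_trans (Jvar _ z _ (uE n)))//.
  have : n%:R > `|z| ^+ 2 / e ^+ 2.
    by near: n; exact: nbhs_infty_gtr.
  rewrite ltr_pdivrMr ?exprn_gt0// => h.
  rewrite ler_pdivrMr// mulrC (le_trans (ltW h))//.
  by rewrite ler_wpM2r ?sqr_ge0// ler_nat.
have /cauchy_cvgP uc : cauchy (u @ \oo).
  apply/cauchy_exP => e e0.
  have e20 : 0 < e ^+ 2 by rewrite exprn_gt0.
  pose n := Num.truncn (4 / e ^+ 2).
  have hn : 4 / e ^+ 2 < n.+1%:R by exact: truncnS_gt.
  exists (u n); exists n => //= k /= nk.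
  rewrite -ball_normE /= -(@ltr_pXn2r _ 2)// ?nnegrE ?(ltW e0)//.
  apply: le_lt_trans (Jnear _ _ _ _ (uE n) (uE k)) _.
  have kn : k.+1%:R^-1 <= n.+1%:R^-1 :> R by rewrite lef_pV2 ?posrE// ler_nat.
  have : n.+1%:R^-1 < e ^+ 2 / 4.
    by rewrite -[ltRHS]invrK ltf_pV2 ?posrE ?invr_gt0 ?divr_gt0// invf_div.
  move: (k.+1%:R^-1) (n.+1%:R^-1) kn => a b; lra.
exists (lim (u @ \oo)) => z.
have H : (fun n => ip (u n) z) @ \oo --> ip (lim (u @ \oo)) z.
  by apply: (cvg_comp u (fun x => ip x z) uc); exact: continuous_ipl.
rewrite ipC.
exact: (cvg_unique (@Rhausdorff R) (u_lim z) H).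
Unshelve. all: by end_near. Qed.

Lemma adjointE T x y : bounded_linear T -> ip (T x) y = ip x (adjoint ip T y).
Proof.
move=> [lT cT].
have [z zE] : exists z, forall x, ip (T x) y = ip x z.
  apply: riesz_representation.
    by move=> k u v; rewrite lT ipP.
  have [C C0 H] : exists2 C, 0 < C & forall x, `|ip (T x) y| <= C * `|x|.
    apply: (@bounded_functional (fun x => ip (T x) y)).
      by move=> k u v; rewrite lT ipP.
    move=> u; apply: (@continuous_comp _ _ _ T (fun v => ip v y)); first exact: cT.
    exact: continuous_ipl.
  by exists C.
rewrite /adjoint; apply: (@xgetPex _ _ [set z | forall x, ip (T x) y = ip x z]).
by exists z.
Qed.

Lemma adjoint_linear T : bounded_linear T -> linear (adjoint ip T).
Proof.
move=> bT k x y; apply: ip_injr => z.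
by rewrite -adjointE// !(ipDr, ipZr) -!adjointE.
Qed.

(** The functionals [<Q x, .>] with [|x| <= 1] are pointwise bounded, as
[<Q x, y> = <x, Q y>], hence uniformly bounded by Banach-Steinhaus; at
[y = Q x / |Q x|] this bounds [|Q x|]. *)
Lemma hellinger_toeplitz (Q : X -> X) : (forall x y, ip (Q x) y = ip x (Q y)) ->
  bounded_linear Q.
Proof.
move=> Qsym.
have lQ : linear Q.
  move=> k x y; apply: ip_injl => z.
  by rewrite Qsym !ipP !Qsym.
split => //.
pose g : {linear X -> X} := HB.pack Q (GRing.isLinear.Build R X X _ Q lQ).
pose F : set (X -> R^o) := [set fun y => ip (Q x) y | x in [set x | `|x| <= 1]].
have [||M HM] := @Banach_Steinhauss R X R^o F _ _ 1.
- move=> _ [x _ <-]; split.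
    move=> r; exists (`|Q x| * r) => y yr.
    by rewrite (le_trans (cauchy_schwarz _ _))// ler_wpM2l.
  by move=> k u v; rewrite ipDr ipZr.
- move=> y; exists `|Q y| => _ [x x1 <-].
  rewrite Qsym (le_trans (cauchy_schwarz _ _))// ler_piMl//.
have Qb x : `|x| <= 1 -> `|Q x| <= M.
  move=> x1; have [->|Q0] := eqVneq (Q x) 0.
    have := HM (fun y => ip (Q x) y) (ex_intro2 _ _ x x1 erefl) 0.
    by rewrite !normr0 => /(_ ler01); apply: le_trans.
  have := HM (fun y => ip (Q x) y) (ex_intro2 _ _ x x1 erefl) (`|Q x|^-1 *: Q x).
  rewrite normrZ normfV normr_id mulVf ?normr_eq0// => /(_ (lexx _)).
  rewrite ipZr -hip expr2 mulrA mulVf ?normr_eq0// mul1r.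
  by apply: le_trans; exact: ler_norm.
suff : continuous g by [].
apply/linear_bounded_continuous/linear_boundedP.
exists M; split; first exact: num_real.
move=> N MN x; have [->|x0] := eqVneq x 0.
  by rewrite raddf0 !normr0 mulr0.
have : `|g (`|x|^-1 *: x)| <= M.
  by apply: Qb; rewrite normrZ normfV normr_id mulVf// normr_eq0.
rewrite linearZ normrZ normfV normr_id ler_pdivrMl ?normr_gt0// mulrC.
by move/le_trans; apply; rewrite ler_wpM2r// ltW.
Qed.

(** Cauchy-Schwarz for the form [<Q x, y>]. *)
Lemma positive_op_form_eq0 (Q : X -> X) h :
  positive_op ip Q -> ip (Q h) h = 0 -> Q h = 0.
Proof.
move=> [[lQ _] Qsym Qge0] q0; apply: ip_injl => y; rewrite ip0l.
have qC x z : ip (Q x) z = ip (Q z) x by rewrite Qsym ipC.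
have qP k x z u : ip (Q (k *: x + z)) u = k * ip (Q x) u + ip (Q z) u.
  by rewrite lQ ipP.
have := positive_form_cauchy_schwarz qC qP Qge0 h y.
by rewrite q0 mul0r => H; apply/eqP; rewrite -sqrf_eq0 eq_le H sqr_ge0.
Qed.

End HilbertSpace.

Arguments ipC {R X ip}.
Arguments ipP {R X ip}.
Arguments ip0l {R X ip}.
Arguments ipDl {R X ip}.
Arguments ipZl {R X ip}.
Arguments ipNl {R X ip}.
Arguments ipDr {R X ip}.
Arguments ipZr {R X ip}.
Arguments ipNr {R X ip}.

(** * Weak integrals of families of positive operators *)

Section WeakIntegral.
Context {R : realType} {X : completeNormedModType R}.
Variable ip : {dot X for idfun}.
Hypothesis hip : hilbert_norm ip.

Lemma integral_XP (D : set R) (F : R -> X) :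
  (exists z, is_integral ip D F z) -> is_integral ip D F (integral_X ip D F).
Proof. by move=> H; apply: xgetPex. Qed.

(* [F x r] is a positive operator applied to [x], for each [r] in [D]. *)
Variables (D : set R) (F : X -> R -> X) (Z : X -> X).
Hypothesis mD : measurable (D : set (measurableTypeR R)).
Hypothesis Flin : forall k x y r, D r -> F (k *: x + y) r = k *: F x r + F y r.
Hypothesis Fsym : forall x y r, D r -> ip (F x r) y = ip (F y r) x.
Hypothesis Fge0 : forall x r, D r -> 0 <= ip (F x r) x.
Hypothesis ZE : forall x, is_integral ip D (F x) (Z x).

Let mu : {measure set (measurableTypeR R) -> \bar R} := @lebesgue_measure R.

Lemma integral_family_ge0 x : 0 <= ip (Z x) x.
Proof. by rewrite (ZE x x).2; apply: Rintegral_ge0 => r /Fge0. Qed.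

Lemma integral_family_sym x y : ip (Z x) y = ip x (Z y).
Proof.
rewrite (ipC x) (ZE x y).2 (ZE y x).2; apply: eq_Rintegral => r.
by rewrite inE => Dr; rewrite Fsym.
Qed.

(** By Hellinger-Toeplitz, symmetry of [Z] gives its boundedness. *)
Lemma positive_op_integral_family : positive_op ip Z.
Proof.
split; last exact: integral_family_ge0.
- apply: (hellinger_toeplitz hip); exact: integral_family_sym.
- exact: integral_family_sym.
Qed.

(** The form [q(x, y)], the integral of [<F x r, y>] over [E], is dominated on
the diagonal by the form of the bounded operator [Z], so Cauchy-Schwarz makes
[q(x, .)] a bounded functional, which Riesz represents by a vector. *)
Lemma is_integral_sub (E : set R) : measurable (E : set (measurableTypeR R)) ->
  E `<=` D -> forall x, exists z, is_integral ip E (F x) z.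
Proof.
move=> mE ED.
have iE x y : mu.-integrable E (fun r => (ip (F x r) y)%:E).
  by apply: integrableS (ZE x y).1.
pose q x y := \int[mu]_(r in E) ip (F x r) y.
have qC x y : q x y = q y x.
  by apply: eq_Rintegral => r; rewrite inE => /ED Dr; exact: Fsym.
have qP k x y z : q (k *: x + y) z = k * q x z + q y z.
  have ikx : mu.-integrable E (EFin \o (fun r => k * ip (F x r) z)).
    by apply: eq_integrable (integrableZl mE k (iE x z)) => //.
  have -> : k * q x z = \int[mu]_(r in E) (k * ip (F x r) z).
    by rewrite RintegralZl//; exact: iE.
  have -> : q y z = \int[mu]_(r in E) ip (F y r) z by [].
  rewrite -RintegralD//; last exact: iE.
  apply: eq_Rintegral => r; rewrite inE => /ED Dr.
  by rewrite Flin// ipP.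
have q_ge0 x : 0 <= q x x by apply: Rintegral_ge0 => r /ED /Fge0.
have qZ x : q x x <= ip (Z x) x.
  rewrite (ZE x x).2 /q /Rintegral; apply: fine_le.
  - by apply: integrable_fin_num => //; exact: iE.
  - by apply: integrable_fin_num => //; exact: (ZE x x).1.
  apply: ge0_subset_integral => //.
    exact: measurable_int (ZE x x).1.
  by move=> r Dr; rewrite lee_fin Fge0.
have [[lZ cZ] _ _] := positive_op_integral_family.
have [C C0 ZC] : exists2 C, 0 < C & forall x, q x x <= C * `|x| ^+ 2.
  pose g : {linear X -> X} := HB.pack Z (GRing.isLinear.Build R X X _ Z lZ).
  have /linear_bounded_continuous/linear_boundedP : continuous g by [].
  move=> [M [Mr H]]; exists (`|M| + 1); first by rewrite ltr_wpDl.
  move=> x; rewrite (le_trans (qZ _))// (le_trans (ler_norm _))//.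
  rewrite (le_trans (cauchy_schwarz hip _ _))// expr2 mulrA ler_wpM2r//.
  by apply: H; rewrite (le_lt_trans (ler_norm M))// ltrDl.
move=> x.
have [z zE] : exists z, forall y, q x y = ip y z.
  apply: (riesz_representation hip).
    by move=> k u v; rewrite !(qC x) qP.
  exists (C * `|x|) => y.
  rewrite -(@ler_pXn2r _ 2)// ?nnegrE ?mulr_ge0//; last exact: ltW.
  rewrite real_normK ?num_real//.
  rewrite (le_trans (positive_form_cauchy_schwarz qC qP q_ge0 _ _))//.
  have -> : (C * `|x| * `|y|) ^+ 2 = (C * `|x| ^+ 2) * (C * `|y| ^+ 2) by ring.
  by rewrite ler_pM.
by exists z => y; split; [exact: iE|rewrite ipC -zE].
Qed.

End WeakIntegral.

Section TraceHalfLine.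
Context {R : realType} {X : completeNormedModType R}.
Variable ip : {dot X for idfun}.
Hypothesis hip : hilbert_norm ip.
Variables (t : R) (F : X -> R -> X) (Z : X -> X).
Hypothesis Flin : forall k x y r, r <= t -> F (k *: x + y) r = k *: F x r + F y r.
Hypothesis Fsym : forall x y r, r <= t -> ip (F x r) y = ip (F y r) x.
Hypothesis Fge0 : forall x r, r <= t -> 0 <= ip (F x r) x.
Hypothesis ZE : forall x, is_integral ip `]-oo, t] (F x) (Z x).

Let mu : {measure set (measurableTypeR R) -> \bar R} := @lebesgue_measure R.

(** A finite partial sum of the trace of [Z] is the integral over the half-line of
a non-negative function, thus the limit of its integrals over [[t - n, t]],
which are partial sums of the traces on these intervals. *)
Lemma le_trace_half_line :
  (trace ip Z <= ereal_sup
    [set trace ip (fun x => integral_X ip `[s, t] (F x)) | s in [set s | (s <= t)%R]])%E.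
Proof.
set S := ereal_sup _.
apply: ge_ereal_sup => _ [A [finA AE] <-].
pose g e (r : measurableTypeR R) : \bar R := (ip (F e r) e)%:E.
have mg e : measurable_fun (`]-oo, t]%classic : set (measurableTypeR R)) (g e).
  exact: measurable_int (ZE e e).1.
have g0 e r : r <= t -> (0 <= g e r)%E by move=> rt; rewrite lee_fin Fge0.
have -> : (\sum_(e \in A) (ip (Z e) e)%:E =
    \int[mu]_(r in `]-oo, t]) \sum_(e \in A) g e r)%E.
  rewrite ge0_integral_fsum//.
  apply: eq_fsbigr => e _.
  rewrite (ZE e e).2 /Rintegral fineK//.
  by apply: integrable_fin_num => //; exact: (ZE e e).1.
pose E n : set (measurableTypeR R) := `[t - n%:R, t]%classic.
have ED n : E n `<=` `]-oo, t]%classic.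
  by move=> r; rewrite /E /= !in_itv/= => /andP[].
have -> : `]-oo, t]%classic = \bigcup_n E n.
  apply/seteqP; split => [r|r [n _]]; last exact: ED.
  rewrite /= in_itv/= => rt; exists (Num.truncn (t - r)).+1 => //.
  rewrite /E /= in_itv/= rt andbT lerBlDl -lerBlDr.
  by rewrite ltW// truncnS_gt.
have mE n : measurable (E n) by exact: measurable_itv.
have mgE n e : measurable_fun (E n) (g e).
  by apply: (measurable_funS _ (@ED n)) => //.
have gE0 n e r : E n r -> (0 <= g e r)%E.
  by move=> /ED /=; rewrite in_itv/=; exact: g0.
have cvgE : (\int[mu]_(r in E n) \sum_(e \in A) g e r @[n --> \oo] -->
    \int[mu]_(r in \bigcup_n E n) \sum_(e \in A) g e r)%E.
  apply: ge0_nondecreasing_set_cvg_integral => //.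
  - move=> m n mn; rewrite subsetEset => r.
    rewrite /E /= !in_itv/= => /andP[mr ->]; rewrite andbT (le_trans _ mr)//.
    by rewrite lerD2l lerN2 ler_nat.
  - move=> n; apply: emeasurable_fsum => // e.
  - by move=> n r Er; apply: fsume_ge0 => e _; exact: gE0 Er.
rewrite -(cvg_lim _ cvgE)//; apply: lime_le.
  by apply/cvg_ex; eexists; exact: cvgE.
apply: nearW => n.
have IE e : is_integral ip (E n) (F e) (integral_X ip (E n) (F e)).
  apply: integral_XP; apply: (@is_integral_sub _ _ _ hip `]-oo, t]%classic F Z) => //.
apply: (@le_trans _ _ (trace ip (fun x => integral_X ip (E n) (F x)))); last first.
  by apply: ereal_sup_ubound; exists (t - n%:R) => //=; rewrite gerBl.
apply: le_ereal_sup_tmp.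
exists (\int[mu]_(r in E n) \sum_(e \in A) g e r)%E => //.
exists A => //.
rewrite ge0_integral_fsum//; last by move=> e r; exact: gE0.
apply: eq_fsbigr => e _.
rewrite (IE e e).2 /Rintegral fineK//.
by apply: integrable_fin_num => //; exact: (IE e e).1.
Qed.

End TraceHalfLine.

Section Translation.
Context {R : realType}.
Let mu : {measure set (measurableTypeR R) -> \bar R} := @lebesgue_measure R.

Lemma lebesgue_measure_shift (T : R) (A : set (measurableTypeR R)) :
  measurable A ->
  pushforward mu (fun r : measurableTypeR R => r + T : measurableTypeR R) A = mu A.
Proof.
move=> mA.
have mshift : measurable_fun setT
    (fun r : measurableTypeR R => r + T : measurableTypeR R).
  exact: measurable_funD.
apply/esym; apply: lebesgue_measure_unique => //= _ [[a b]] _ <-.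
rewrite /pushforward.
have -> : (fun r => r + T) @^-1` `]a, b]%classic = `]a - T, b - T]%classic.
  by apply/seteqP; split => r /=; rewrite !in_itv/= ltrBlDr lerBrDr.
rewrite !lebesgue_measure_itv/= !lte_fin ltrD2r; case: ifP => // _.
by rewrite -!EFinD; congr EFin; ring.
Qed.

Lemma Rintegral_shift (T : R) (D : set (measurableTypeR R)) (f : R -> R) :
  measurable D -> mu.-integrable D (EFin \o f) ->
  \int[mu]_(r in D) f r =
  \int[mu]_(r in (fun r => r + T) @^-1` D) f (r + T).
Proof.
move=> mD fi.
have mshift : measurable_fun setT
    (fun r : measurableTypeR R => r + T : measurableTypeR R).
  exact: measurable_funD.
have pushmu A : measurable A -> A `<=` setT ->
    mu A = pushforward mu (fun r : measurableTypeR R => r + T : measurableTypeR R) A.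
  by move=> mA _; rewrite lebesgue_measure_shift.
pose h := (EFin \o f) \_ D.
have ih : mu.-integrable setT h by exact/(integrable_mkcond _ mD).1.
have mh : measurable_fun setT h by exact: measurable_int ih.
rewrite /Rintegral integral_mkcond -/h [in RHS]integral_mkcond.
congr fine.
rewrite (eq_measure_integral _ pushmu).
rewrite integral_pushforward//; last first.
  apply/integrableP; split; first exact: measurableT_comp.
  rewrite [ltLHS](_ : _ = \int[mu]_x `|h x|)%E; first by have /integrableP[] := ih.
  rewrite [RHS](eq_measure_integral _ pushmu) ge0_integral_pushforward//.
  exact: measurableT_comp.
Qed.

End Translation.

(** * Moments of centred Gaussian measures *)

Section NormalExponential.
Context {R : realType}.
Let leb : {measure set (measurableTypeR R) -> \bar R} := @lebesgue_measure R.

(** The density of the normal law is its Radon-Nikodym derivative. *)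
Lemma integral_normal_prob (s : R) (g : measurableTypeR R -> \bar R) :
  measurable_fun setT g -> (forall u, 0 <= g u)%E ->
  (\int[normal_prob 0 s]_u g u = \int[leb]_u (g u * (normal_pdf 0 s u)%:E))%E.
Proof.
move=> mg g0.
have dom : normal_prob 0 s `<< leb by exact: normal_prob_dominates.
rewrite -(Radon_Nikodym_SigmaFinite.change_of_variables dom g0 measurableT mg).
have fi := Radon_Nikodym_SigmaFinite.f_integrable dom.
have mpdf : measurable_fun setT (fun u : measurableTypeR R => (normal_pdf 0 s u)%:E).
  by apply/measurable_EFinP; exact: measurable_normal_pdf.
apply: ge0_ae_eq_integral => //.
- by apply: emeasurable_funM => //; exact: measurable_int fi.
- exact: emeasurable_funM.
- by move=> u _; rewrite mule_ge0// Radon_Nikodym_SigmaFinite.f_ge0.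
- by move=> u _; rewrite mule_ge0// lee_fin normal_pdf_ge0.
apply: ae_eqe_mul2l.
apply: integral_ae_eq => // A _ mA.
by rewrite -Radon_Nikodym_SigmaFinite.f_integral.
Qed.

(** Completing the square turns [expR u] times the density of [N(0, s^2)] into a
multiple of the density of [N(s^2, s^2)]. *)
Lemma integral_expR_normal_prob (s : R) : s != 0 ->
  (\int[normal_prob 0 s]_u (expR u)%:E = (expR (s ^+ 2 / 2))%:E)%E.
Proof.
move=> s0; have mexp : measurable_fun setT (fun u : measurableTypeR R => (expR u)%:E).
  by apply/measurable_EFinP; exact: measurable_expR.
rewrite (integral_normal_prob s mexp); last first.
  by move=> u; rewrite lee_fin expR_ge0.
have E u : expR u * normal_pdf 0 s u = expR (s ^+ 2 / 2) * normal_pdf (s ^+ 2) s u.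
  rewrite !normal_pdfE// mulrCA [RHS]mulrCA -!expRD; congr (_ * expR _).
  by rewrite -mulr_natr; field.
under eq_integral do rewrite -EFinM E EFinM.
rewrite ge0_integralZl//.
- by rewrite integral_normal_pdf mule1.
- by apply/measurable_EFinP; exact: measurable_normal_pdf.
- by move=> u _; rewrite lee_fin normal_pdf_ge0.
Qed.

End NormalExponential.

Section ExponentialBounds.
Context {R : realType}.

Lemma ler_expR_abs (u : R) : `|u| <= expR `|u|.
Proof. by rewrite (le_trans _ (expR_ge1Dx _))// lerDr. Qed.

Lemma sqr_le_expR_abs (u : R) : u ^+ 2 <= 2 * expR `|u|.
Proof.
have := expR_ge1Dxn 1 (normr_ge0 u).
rewrite real_normK ?num_real// => H; have := H.
by rewrite (_ : 2`!%:R = 2 :> R)//; lra.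
Qed.

End ExponentialBounds.

Section CenteredGaussian.
Context {R : realType} {X : completeNormedModType R}.
Variable ip : {dot X for idfun}.
Hypothesis hip : hilbert_norm ip.

Lemma continuous_borel_measurable (f : X -> R) : continuous f ->
  measurable_fun [set: borel X] (f : borel X -> R).
Proof.
move=> cf.
apply: (measurability _ (RGenOpens.measurableE R)) => _ [_ [a [b ->] <-]].
rewrite setTI; apply: sub_sigma_algebra.
by have /continuousP := cf; apply; exact: interval_open.
Qed.

Lemma measurable_ip h : measurable_fun [set: borel X] (fun x : borel X => ip x h).
Proof. by apply: continuous_borel_measurable; exact: continuous_ipl. Qed.

Variables (mu : probability (borel X) R) (Q : X -> X).
Hypothesis Qpos : positive_op ip Q.
Hypothesis muQ : is_gaussian ip mu 0 Q.

Let ip_fun h : borel X -> measurableTypeR R := fun x => ip x h.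

Let mip h : measurable_fun setT (ip_fun h). Proof. exact: measurable_ip. Qed.

Lemma gaussian_lawE h A : measurable A ->
  pushforward mu (ip_fun h) A = gaussian1 0 (ip (Q h) h) A.
Proof. by move=> mA; have := muQ h mA; rewrite ip0l. Qed.

Lemma gaussian_exp_integral_lty h : (\int[mu]_x (expR (ip x h))%:E < +oo)%E.
Proof.
have mexp : measurable_fun setT (fun u : measurableTypeR R => (expR u)%:E).
  by apply/measurable_EFinP; exact: measurable_expR.
have -> : (\int[mu]_x (expR (ip x h))%:E =
    \int[pushforward mu (ip_fun h)]_u (expR u)%:E)%E.
  rewrite (ge0_integral_pushforward (mip h) mu measurableT mexp) ?preimage_setT//.
have [v0|v0] := eqVneq (ip (Q h) h) 0.
  rewrite (eq_measure_integral (dirac (0 : measurableTypeR R))) => [|A mA _]; last first.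
    by apply: (etrans (gaussian_lawE h mA)); rewrite /gaussian1 v0 eqxx.
  by rewrite integral_dirac// diracT mul1e ltry.
have vge0 : 0 <= ip (Q h) h by have [_ _] := Qpos; apply.
pose nu : {measure set (measurableTypeR R) -> \bar R} :=
  normal_prob 0 (Num.sqrt (ip (Q h) h)).
rewrite (eq_measure_integral nu) => [|A mA _]; last first.
  by apply: (etrans (gaussian_lawE h mA)); rewrite /gaussian1 (negbTE v0).
rewrite /nu integral_expR_normal_prob ?ltry//.
by rewrite gt_eqF// sqrtr_gt0 lt_neqAle eq_sym v0.
Qed.

Lemma gaussian_exp_abs_integral_lty h : (\int[mu]_x (expR `|ip x h|)%:E < +oo)%E.
Proof.
have m k : measurable_fun setT (fun x : borel X => (expR (ip x k))%:E).
  by apply/measurable_EFinP/measurableT_comp => //; exact: measurable_ip.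
apply: (@le_lt_trans _ _ (\int[mu]_x ((expR (ip x h))%:E + (expR (ip x (- h)))%:E)))%E.
  apply: ge0_le_integral => //.
  - apply/measurable_EFinP/measurableT_comp => //; apply: measurableT_comp => //.
    exact: measurable_ip.
  - exact: emeasurable_funD.
  - move=> x _; rewrite -EFinD lee_fin ipNr.
    have [h0|h0] := leP 0 (ip x h).
      by rewrite ger0_norm// lerDl expR_ge0.
    by rewrite ltr0_norm// lerDr expR_ge0.
rewrite ge0_integralD//.
by rewrite lte_add_pinfty// gaussian_exp_integral_lty.
Qed.

(** Raising [expR |<x, h>|] to the power [p] replaces [h] with [p h], so the
exponential moments for all [h] bound the moments of every order. *)
Lemma Lfun_exp_dominated (p : R) (f : borel X -> R) (C : R) h :
  1 <= p -> measurable_fun setT f ->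
  (forall x, `|f x| <= C * expR `|ip x h|) -> f \in Lfun mu p%:E.
Proof.
move=> p1 mf fC; have p0 : 0 < p by rewrite (lt_le_trans ltr01).
rewrite inE; apply/andP; split; first by rewrite inE.
rewrite inE /= /finite_norm unlock poweR_lty//.
have C0 : 0 <= C.
  have := fC 0; rewrite ip0l normr0 expR0 mulr1; exact: le_trans.
apply: (@le_lt_trans _ _ (\int[mu]_x ((C `^ p)%:E * (expR `|ip x (p *: h)|)%:E)))%E.
  apply: ge0_le_integral => //.
  - by move=> x _; exact: poweR_ge0.
  - apply/measurable_EFinP.
    by apply: (measurableT_comp (measurable_powR p)); exact: measurableT_comp.
  - apply/measurable_EFinP; apply: measurable_funM => //.
    apply/measurableT_comp => //; apply: measurableT_comp => //.
    exact: measurable_ip.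
  - move=> x _; rewrite -EFinM lee_fin ipZr normrM (gtr0_norm p0) (mulrC p).
    rewrite expRM -powRM ?expR_ge0//.
    by rewrite ge0_ler_powR ?nnegrE ?mulr_ge0 ?expR_ge0// ltW.
rewrite ge0_integralZl//.
- by rewrite lte_mul_pinfty// ?lee_fin ?powR_ge0// gaussian_exp_abs_integral_lty.
- apply/measurable_EFinP/measurableT_comp => //; apply: measurableT_comp => //.
  exact: measurable_ip.
- by rewrite lee_fin powR_ge0.
Qed.

Lemma Lfun_ip (p : R) h : 1 <= p -> (fun x : borel X => ip x h) \in Lfun mu p%:E.
Proof.
move=> p1; apply: (@Lfun_exp_dominated p _ 1 h p1); first exact: measurable_ip.
by move=> x; rewrite mul1r ler_expR_abs.
Qed.

Lemma Lfun_ip_sqr (p : R) h : 1 <= p ->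
  (fun x : borel X => ip x h ^+ 2) \in Lfun mu p%:E.
Proof.
move=> p1; apply: (@Lfun_exp_dominated p _ 2 h p1).
  by apply: measurable_funX; exact: measurable_ip.
by move=> x; rewrite (ger0_norm (sqr_ge0 _)); exact: sqr_le_expR_abs.
Qed.

Lemma integrable_ip h : mu.-integrable setT (fun x : borel X => (ip x h)%:E).
Proof. by apply/Lfun1_integrable; exact: Lfun_ip. Qed.

Lemma integrable_ip_sqr h :
  mu.-integrable setT (fun x : borel X => (ip x h ^+ 2)%:E).
Proof.
by apply/(@Lfun1_integrable _ _ _ mu (fun x => ip x h ^+ 2)); exact: Lfun_ip_sqr.
Qed.

(** [<., h>] and [<., - h>] have the same law. *)
Lemma gaussian_mean0 h : \int[mu]_(x in [set: borel X]) ip x h = 0.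
Proof.
have mEFin : measurable_fun setT (@EFin R : measurableTypeR R -> \bar R).
  by apply/measurable_EFinP; exact: measurable_id.
have E k : (\int[mu]_x (ip x k)%:E = \int[pushforward mu (ip_fun k)]_u u%:E)%E.
  rewrite (integral_pushforward (mip k) mEFin) ?preimage_setT//.
  exact: integrable_ip.
have H : \int[mu]_(x in [set: borel X]) ip x (- h) =
         \int[mu]_(x in [set: borel X]) ip x h.
  rewrite /Rintegral !E; congr fine; apply: eq_measure_integral => A mA _.
  move: Qpos => [[lQ _] _ _].
  apply: (etrans (gaussian_lawE (- h) mA)); apply: esym.
  apply: (etrans (gaussian_lawE h mA)).
  pose g : {linear X -> X} := HB.pack Q (GRing.isLinear.Build R X X _ Q lQ).
  have -> : Q (- h) = - Q h by exact: (linearN g).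
  by rewrite ipNl ipNr opprK.
have : \int[mu]_(x in [set: borel X]) ip x (- h) =
       - \int[mu]_(x in [set: borel X]) ip x h.
  transitivity (\int[mu]_(x in [set: borel X]) (-1 * ip x h)).
    by apply: eq_Rintegral => x _; rewrite ipNr mulN1r.
  by rewrite RintegralZl ?mulN1r//; exact: integrable_ip.
by rewrite H; lra.
Qed.

(** A normal law with non-zero variance does not charge the point [0]. *)
Lemma gaussian_Lnorm_gt0 (p : R) h : 1 <= p -> ip (Q h) h != 0 ->
  (0 < 'N[mu]_(p%:E)[EFin \o (fun x : borel X => ip x h)])%E.
Proof.
move=> p1 v0; rewrite lt_neqAle Lnorm_ge0 andbT eq_sym.
apply/eqP => /Lnorm_eq0_eq0 H.
have {}H : {ae mu, forall x : borel X, ip x h = 0}.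
  have mh : measurable_fun setT (fun x : borel X => (ip x h)%:E).
    by apply/measurable_EFinP; exact: measurable_ip.
  have := H mh; rewrite lte_fin (lt_le_trans ltr01 p1) => /(_ erefl).
  by apply: filterS => x /(_ I) [].
pose nu : {measure set (measurableTypeR R) -> \bar R} :=
  normal_prob 0 (Num.sqrt (ip (Q h) h)).
have n0 : nu [set 0] = 0%E.
  have /null_content_dominatesP := @normal_prob_dominates R 0 (Num.sqrt (ip (Q h) h)).
  by apply => //; exact: lebesgue_measure_set1.
pose A : set (borel X) := [set x | ip x h = 0].
have mA : measurable A.
  by have := @measurable_ip h measurableT [set 0] (measurable_set1 _); rewrite setTI.
have muA0 : mu A = 0%E.
  have := muQ h (measurable_set1 (0 : R)); rewrite /gaussian1 (negbTE v0) ip0l.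
  by move=> muE; rewrite -[RHS]n0 -[RHS]muE.
have muAC : mu (~` A) = 1%E by rewrite probability_setC// muA0 sube0.
have [N [mN N0 AN]] := H.
have : (mu (~` A) <= mu N)%E by rewrite le_measure ?inE//; exact: measurableC.
by rewrite muAC N0 lee_fin ler10.
Qed.

End CenteredGaussian.

(** * Ornstein-Uhlenbeck operators on linear functionals *)

Section LpSeminorm.
Context d (T : measurableType d) (R : realType).
Variables (mu : probability T R) (p : R).
Hypothesis p1 : 1 <= p.
Implicit Types f g : T -> R.

Let p0 : 0 < p. Proof. exact: lt_le_trans p1. Qed.

Lemma Lfun_measurable_norm_lty f : f \in Lfun mu p%:E ->
  measurable_fun setT f /\ ('N[mu]_(p%:E)[EFin \o f] < +oo)%E.
Proof. by rewrite inE => /andP[]; rewrite !inE. Qed.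

Lemma Lnorm_ae_le f g : measurable_fun setT f -> measurable_fun setT g ->
  {ae mu, forall x, `|f x| <= `|g x|} ->
  ('N[mu]_(p%:E)[EFin \o f] <= 'N[mu]_(p%:E)[EFin \o g])%E.
Proof.
move=> mf mg fg; rewrite unlock; apply: gt0_ler_poweR.
- by rewrite invr_ge0 ltW.
- by rewrite in_itv/= leey andbT integral_ge0// => x _; exact: poweR_ge0.
- by rewrite in_itv/= leey andbT integral_ge0// => x _; exact: poweR_ge0.
have mpow (k : T -> R) : measurable_fun setT k ->
    measurable_fun setT (fun x => (`|(EFin \o k) x| `^ p)%E).
  move=> mk; apply/measurable_EFinP.
  by apply: (measurableT_comp (measurable_powR p)); exact: measurableT_comp.
apply: ae_ge0_le_integral => //.
- by move=> x _; exact: poweR_ge0.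
- exact: mpow.
- by move=> x _; exact: poweR_ge0.
- exact: mpow.
apply: filterS fg => x fgx _ /=.
by rewrite lee_fin ge0_ler_powR ?nnegrE// ltW.
Qed.

Lemma Lnorm_ae_eq f g : measurable_fun setT f -> measurable_fun setT g ->
  ae_eq mu setT f g ->
  ('N[mu]_(p%:E)[EFin \o f] = 'N[mu]_(p%:E)[EFin \o g])%E.
Proof.
move=> mf mg fg; apply/le_anti/andP; split; apply: Lnorm_ae_le => //.
  by apply: filterS fg => x /(_ I) ->.
by apply: filterS fg => x /(_ I) ->.
Qed.

Lemma Lnorm_scale f (a : R) : f \in Lfun mu p%:E ->
  ('N[mu]_(p%:E)[EFin \o (fun x => a * f x)%R] =
   `|a|%:E * 'N[mu]_(p%:E)[EFin \o f])%E.
Proof.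
move=> fL; have p1E : (1 <= p%:E)%E by rewrite lee_fin.
exact: (@LnormZ _ _ _ mu p%:E p1E (Lfun_Sub p1E fL) a).
Qed.

Lemma Lfun_linear f g (a : R) : f \in Lfun mu p%:E -> g \in Lfun mu p%:E ->
  (fun x => a * f x + g x) \in Lfun mu p%:E.
Proof.
move=> fL gL; have p1E : (1 <= p%:E)%E by rewrite lee_fin.
exact: (Lfun_submod_closed mu p1E).2.
Qed.

Lemma Lnorm_eq0_of_small f (c : \bar R) : (0 <= c)%E -> (c < +oo)%E ->
  measurable_fun setT f ->
  (forall n : nat, 'N[mu]_(p%:E)[EFin \o f] <= n.+1%:R^-1%:E * c)%E ->
  ae_eq mu setT f (cst 0).
Proof.
move=> c0 cy mf H.
have mEf : measurable_fun setT (EFin \o f) by exact/measurable_EFinP.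
have p0E : (0 < p%:E)%E by rewrite lte_fin.
have : ('N[mu]_(p%:E)[EFin \o f] = 0)%E.
  apply/le_anti; rewrite Lnorm_ge0 andbT.
  have cfin : c \is a fin_num by rewrite ge0_fin_numE.
  apply/lee_addgt0Pr => e e0; rewrite add0e.
  pose n := Num.truncn (fine c / e).
  apply: (le_trans (H n)); rewrite -(fineK cfin) -EFinM lee_fin.
  by rewrite mulrC ler_pdivrMr// mulrC -ler_pdivrMr// ltW// truncnS_gt.
by move=> /(Lnorm_eq0_eq0 mEf p0E); apply: filterS => x /(_ I) [] ->.
Qed.

End LpSeminorm.

Section LinearFunctionals.
Context {R : realType} {X : completeNormedModType R}.
Variable ip : {dot X for idfun}.
Hypothesis hip : hilbert_norm ip.

Definition truncation (k u : R) := Num.max (- k) (Num.min k u).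

Lemma truncation_bounded k u : 0 <= k -> `|truncation k u| <= k.
Proof.
move=> k0; rewrite ler_norml /truncation le_max lexx /= ge_max.
by rewrite (le_trans _ k0) ?oppr_le0// ge_min lexx.
Qed.

Lemma truncation_error k u : 0 < k -> `|truncation k u - u| <= u ^+ 2 / k.
Proof.
move=> k0; rewrite ler_pdivlMr// /truncation.
have [ku|uk] := leP k u.
  rewrite (max_idPr _); last lra.
  by rewrite ler0_norm; nra.
have [Nk|kN] := leP (- k) u.
  by rewrite subrr normr0 mul0r sqr_ge0.
by rewrite ger0_norm; nra.
Qed.

Lemma truncation_le_abs k u : 0 < k -> `|truncation k u| <= `|u|.
Proof.
move=> k0; rewrite /truncation.
have [ku|uk] := leP k u.
  rewrite (max_idPr _); last lra.
  by rewrite !ger0_norm; lra.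
have [Nk|kN] := leP (- k) u; first by [].
by rewrite !ler0_norm; lra.
Qed.

Lemma truncation_lipschitz k u v : `|truncation k u - truncation k v| <= `|u - v|.
Proof.
have h1 := ler_norm (u - v).
have h2 : v - u <= `|u - v| by rewrite distrC ler_norm.
rewrite /truncation ler_norml; apply/andP.
by have [?|?] := leP k u; have [?|?] := leP k v;
  repeat (match goal with |- context [Num.max ?a ?b] => have [?|?] := leP a b end);
  split; lra.
Qed.

Lemma continuous_truncation k : continuous (truncation k : R -> R).
Proof.
move=> u; apply/cvgrPdist_le => e e0; near=> v.
rewrite (le_trans (truncation_lipschitz _ _ _))//; near: v.
Unshelve. all: by end_near. Qed.

Variables (nu : probability (borel X) R) (Q : X -> X).
Hypothesis Qpos : positive_op ip Q.
Hypothesis nuQ : is_gaussian ip nu 0 Q.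

(** By centring, [m] is the mean of [m + <y, h>]; the truncation error of the
integrand is at most [(m + <y, h>)^2 / k]. *)
Lemma truncated_mean_error k h (m : R) : 0 < k ->
  `|\int[nu]_(y in [set: borel X]) truncation k (m + ip y h) - m| <=
  k^-1 * (2 * m ^+ 2 + 2 * \int[nu]_(y in [set: borel X]) ip y h ^+ 2).
Proof.
move=> k0.
have ih := integrable_ip hip Qpos nuQ h.
have ih2 := integrable_ip_sqr hip Qpos nuQ h.
have icst (c : R) : nu.-integrable setT (EFin \o (fun _ : borel X => c)).
  exact: finite_measure_integrable_cst.
have iD (f g : borel X -> R) : nu.-integrable setT (EFin \o f) ->
    nu.-integrable setT (EFin \o g) ->
    nu.-integrable setT (EFin \o (fun x => f x + g x)).
  by move=> fi gi; apply: eq_integrable (integrableD _ fi gi).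
have iZ (c : R) (f : borel X -> R) : nu.-integrable setT (EFin \o f) ->
    nu.-integrable setT (EFin \o (fun x => c * f x)).
  by move=> fi; apply: eq_integrable (integrableZl _ c fi).
have imz : nu.-integrable setT (EFin \o (fun y : borel X => m + ip y h)).
  exact: (iD).
have mtr : measurable_fun setT (fun y : borel X => truncation k (m + ip y h)).
  apply: (measurableT_comp (continuous_measurable_fun (@continuous_truncation k))).
  by apply: measurable_funD => //; exact: measurable_ip.
have itr : nu.-integrable setT (EFin \o (fun y : borel X => truncation k (m + ip y h))).
  apply: le_integrable imz => //.
    exact/measurable_EFinP.
  by move=> y _ /=; rewrite lee_fin truncation_le_abs.
have Em : m = \int[nu]_(y in [set: borel X]) (m + ip y h).
  rewrite RintegralD// (gaussian_mean0 hip Qpos nuQ) addr0.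
  by rewrite Rintegral_cst// /fine/= probability_setT mulr1.
rewrite {2}Em -RintegralB//.
have i1 : nu.-integrable setT
    (EFin \o (fun y : borel X => truncation k (m + ip y h) - (m + ip y h))).
  by apply: eq_integrable (integrableB _ itr imz).
apply: (le_trans (le_normr_Rintegral _ i1)) => //.
apply: (@le_trans _ _ (\int[nu]_(y in [set: borel X])
    (k^-1 * (2 * m ^+ 2 + 2 * ip y h ^+ 2)))).
  apply: le_Rintegral => //.
  - by apply: integrable_norm.
  - by apply: (iZ); apply: (iD) => //; apply: (iZ).
  move=> y _; apply: (le_trans (truncation_error _ k0)).
  have k0' : 0 <= k^-1 by rewrite invr_ge0 ltW.
  rewrite mulrC ler_wpM2l//.
  by have := sqr_ge0 (m - ip y h); lra.
rewrite RintegralZl//; last by apply: (iD) => //; apply: (iZ).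
rewrite RintegralD//; last by apply: (iZ).
rewrite Rintegral_cst// /fine/= probability_setT mulr1 RintegralZl//.

Qed.

Variables (mus mut : probability (borel X) R) (Qs Qt S : X -> X) (p : R).
Hypothesis Qspos : positive_op ip Qs.
Hypothesis musQ : is_gaussian ip mus 0 Qs.
Hypothesis Qtpos : positive_op ip Qt.
Hypothesis mutQ : is_gaussian ip mut 0 Qt.
Hypothesis p1 : 1 <= p.
Variables P0 P : (borel X -> R) -> (borel X -> R).
Hypothesis P0E : forall phi x,
  P0 phi x = \int[nu]_(y in [set: borel X]) phi (S x + y).
Hypothesis PP0 : is_Lp_extension p mus mut P0 P.

(** Let [phi] be the truncation of [<., h>] at height [K = n + 1].  As [P] is a
contraction, [P <., h> - P phi] is [O(1/K)] in [L^p]; and [P phi], given by the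
integral formula, is within [O(1/K)] of [<S x, h> = <x, k>] by
[truncated_mean_error]. *)
Lemma Lp_extension_linear_functional h k :
  (forall x, ip (S x) h = ip x k) ->
  ae_eq mus setT (P (fun x => ip x h)) (fun x => ip x k).
Proof.
move=> Shk.
have [PL Plin Pcontr Pext] := PP0.
have hL := Lfun_ip hip Qtpos mutQ h p1.
have kL := Lfun_ip hip Qspos musQ k p1.
have h2L := Lfun_ip_sqr hip Qtpos mutQ h p1.
have k2L := Lfun_ip_sqr hip Qspos musQ k p1.
pose q := \int[nu]_(y in [set: borel X]) ip y h ^+ 2.
pose G (x : borel X) : R := 2 * ip x k ^+ 2 + 2 * q.
have GL : G \in Lfun mus p%:E.
  by apply: (Lfun_linear p1 2 k2L); exact: Lfun_cst.
pose c := ('N[mut]_(p%:E)[EFin \o (fun x : borel X => ip x h ^+ 2)%R] +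
           'N[mus]_(p%:E)[EFin \o G])%E.
have [mPh PhN] := Lfun_measurable_norm_lty (PL _ hL).
have mk : measurable_fun setT (fun x : borel X => ip x k) by exact: measurable_ip.
have mh : measurable_fun setT (fun x : borel X => ip x h) by exact: measurable_ip.
suff : ae_eq mus setT (fun x => P (fun x => ip x h) x - ip x k) (cst 0).
  by apply: filterS => x /(_ I) /eqP; rewrite subr_eq0 => /eqP.
apply: (@Lnorm_eq0_of_small _ _ _ mus p p1 _ c).
- by rewrite adde_ge0// Lnorm_ge0.
- have [_ h2N] := Lfun_measurable_norm_lty h2L.
  have [_ GN] := Lfun_measurable_norm_lty GL.
  exact: lte_add_pinfty.
- exact: measurable_funB.
move=> n; pose K : R := n.+1%:R.
have K0 : 0 < K by rewrite ltr0n.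
pose phi (x : borel X) := truncation K (ip x h).
have phic : continuous (phi : X -> R).
  move=> x; apply: (@continuous_comp _ _ _ (fun x => ip x h) (truncation K)).
    exact: continuous_ipl.
  exact: continuous_truncation.
have mphi : measurable_fun setT phi by exact: continuous_borel_measurable.
have phiL : phi \in Lfun mut p%:E.
  apply: (@Lfun_exp_dominated _ _ _ hip _ _ Qtpos mutQ p phi 1 h p1) => // x.
  by rewrite mul1r (le_trans (truncation_le_abs _ K0))// ler_expR_abs.
have [mPphi _] := Lfun_measurable_norm_lty (PL _ phiL).
pose dphi (x : borel X) := -1 * phi x + ip x h.
have dL : dphi \in Lfun mut p%:E by exact: (Lfun_linear p1 (-1) phiL hL).
have [mPd _] := Lfun_measurable_norm_lty (PL _ dL).
have Pd := Plin _ _ phiL hL (-1).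
have Pphi := Pext phi phic (ex_intro _ K (fun x => truncation_bounded (ip x h) (ltW K0))).
have mD : measurable_fun setT (fun x => P phi x - ip x k) by exact: measurable_funB.
(* Split [P <., h> - <., k>] at [P phi]. *)
have -> : ('N[mus]_(p%:E)[EFin \o (fun x => P (fun x => ip x h) x - ip x k)%R] =
    'N[mus]_(p%:E)[EFin \o (P dphi \+ (fun x => P phi x - ip x k))%R])%E.
  apply: Lnorm_ae_eq => //.
  - exact: measurable_funB.
  - exact: measurable_funD.
  apply: filterS Pd => x /(_ I) /=; rewrite -/dphi => -> _; ring.
apply: (le_trans (eminkowski mus mPd mD _)); first by rewrite lee_fin.
rewrite ge0_muleDr ?Lnorm_ge0//; apply: leeD.
- apply: (le_trans (Pcontr _ dL)).
  have -> : (n.+1%:R^-1%:E * 'N[mut]_(p%:E)[EFin \o (fun x : borel X => ip x h ^+ 2)%R]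
    = 'N[mut]_(p%:E)[EFin \o (fun x : borel X => K^-1 * ip x h ^+ 2)%R])%E.
    by rewrite Lnorm_scale// gtr0_norm ?invr_gt0.
  apply: Lnorm_ae_le => //.
  + exact: (Lfun_measurable_norm_lty dL).1.
  + by apply: measurable_funM => //; exact: (Lfun_measurable_norm_lty h2L).1.
  apply: nearW => x; rewrite /dphi mulN1r addrC distrC.
  apply: (le_trans (truncation_error _ K0)).
  by rewrite mulrC ler_norm.
- have -> : (n.+1%:R^-1%:E * 'N[mus]_(p%:E)[EFin \o G]
    = 'N[mus]_(p%:E)[EFin \o (fun x => K^-1 * G x)%R])%E.
    by rewrite Lnorm_scale// gtr0_norm ?invr_gt0.
  apply: Lnorm_ae_le => //.
  + by apply: measurable_funM => //; exact: (Lfun_measurable_norm_lty GL).1.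
  apply: filterS Pphi => x /(_ I) ->.
  rewrite P0E.
  have -> : \int[nu]_(y in [set: borel X]) phi (S x + y) =
      \int[nu]_(y in [set: borel X]) truncation K (ip x k + ip y h).
    by apply: eq_Rintegral => y _; rewrite /phi ipDl Shk.
  by rewrite (le_trans (truncated_mean_error _ _ K0))// ler_norm.
Qed.

End LinearFunctionals.

Section ExtensionRespectsAe.
Context {R : realType} {X : completeNormedModType R}.
Variables (p : R) (mus mut : probability (borel X) R).
Variables P0 P : (borel X -> R) -> (borel X -> R).
Hypothesis p1 : 1 <= p.
Hypothesis PP0 : is_Lp_extension p mus mut P0 P.

(** An extension acts on representatives; this makes it iterable up to
almost-everywhere equality. *)
Lemma Lp_extension_ae_eq f g : f \in Lfun mut p%:E -> g \in Lfun mut p%:E ->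
  ae_eq mut setT f g -> ae_eq mus setT (P f) (P g).
Proof.
move=> fL gL fg.
have [PL Plin Pcontr _] := PP0.
pose d (x : borel X) := -1 * g x + f x.
have dL : d \in Lfun mut p%:E by exact: (Lfun_linear p1 (-1) gL fL).
have d0 : ('N[mut]_(p%:E)[EFin \o d] = 0)%E.
  have p0 : (p%:E != 0)%E by rewrite eqe gt_eqF// (lt_le_trans ltr01).
  rewrite -(Lnorm0 mut p0).
  apply: (@Lnorm_ae_eq _ _ _ mut p p1 d (cst 0)) => //.
    exact: (Lfun_measurable_norm_lty dL).1.
  by apply: filterS fg => x /(_ I) fgx _; rewrite /d fgx /= mulN1r addNr.
have Pd0 : ae_eq mus setT (P d) (cst 0).
  apply: (@Lnorm_eq0_of_small _ _ _ mus p p1 _ 0%E) => //.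
    exact: (Lfun_measurable_norm_lty (PL _ dL)).1.
  by move=> n; rewrite mule0 -d0; exact: Pcontr.
apply: filterS2 (Plin _ _ gL fL (-1)) Pd0 => x /(_ I) E /(_ I) E0 _.
have {E} := etrans (esym E) E0; rewrite /= mulN1r addrC.
by move/eqP; rewrite subr_eq0 => /eqP.
Qed.

End ExtensionRespectsAe.

(** * Growth of powers along an eigenvector *)

Section RotationGrowth.
Context {R : realType} {X : lmodType R}.
Variables (V : X -> X) (s : X -> R) (h1 h2 : X) (a b : R).
Hypothesis Vlin : linear V.
Hypothesis Vh1 : V h1 = a *: h1 - b *: h2.
Hypothesis Vh2 : V h2 = b *: h1 + a *: h2.
Hypothesis s_ge0 : forall h, 0 <= s h.
Hypothesis s_gt0 : forall h, h != 0 -> 0 < s h.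
Hypothesis s_le : forall c d h k, s (c *: h + d *: k) <= `|c| * s h + `|d| * s k.
Hypothesis h_neq0 : (h1 != 0) || (h2 != 0).

(* Real and imaginary part of [(a + i b)^n]. *)
Let pw n := iter n (fun q => (a * q.1 - b * q.2, b * q.1 + a * q.2)) (1, 0).

Let linD c d h k : V (c *: h + d *: k) = c *: V h + d *: V k.
Proof. by rewrite Vlin (linear_mapZ Vlin). Qed.

Lemma iter_rotation n :
  iter n V h1 = (pw n).1 *: h1 + (- (pw n).2) *: h2 /\
  iter n V h2 = (pw n).2 *: h1 + (pw n).1 *: h2.
Proof.
elim: n => [|n [IH1 IH2]].
  by rewrite /= oppr0 !scale0r !scale1r addr0 add0r.
rewrite !iterS IH1 IH2 !linD Vh1 Vh2 -scaleNr /=; move: (pw n) => [c d] /=.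
by split; rewrite !scalerDr !scalerA addrACA -!scalerDl;
  congr (_ *: _ + _ *: _); ring.
Qed.

Lemma sqr_pw n : (pw n).1 ^+ 2 + (pw n).2 ^+ 2 = (a ^+ 2 + b ^+ 2) ^+ n.
Proof.
elim: n => [|n IH]; first by rewrite /= !expr1n expr0n addr0.
by rewrite [in RHS]exprS -IH /=; ring.
Qed.

(** Writing [(a + i b)^n = c + i d] with modulus [r], inverting the rotation gives
[r^2 h1 = c V^n h1 + d V^n h2] and [r^2 h2 = - d V^n h1 + c V^n h2].  Applying
[s] and adding up yields [r^2 M <= 2 r e M] for [M = s h1 + s h2]. *)
Lemma rotation_growth n e :
  (forall h, s (iter n V h) <= e * s h) ->
  Num.sqrt (a ^+ 2 + b ^+ 2) ^+ n <= 2 * e.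
Proof.
move=> He.
set r := Num.sqrt _ ^+ n.
have [E1 E2] := iter_rotation n.
have r2 : r ^+ 2 = (pw n).1 ^+ 2 + (pw n).2 ^+ 2.
  by rewrite sqr_pw /r exprAC sqr_sqrtr// addr_ge0// sqr_ge0.
move: E1 E2 r2; case: (pw n) => c d /= E1 E2 r2.
have r0 : 0 <= r by rewrite exprn_ge0// sqrtr_ge0.
have cr : `|c| <= r.
  rewrite -(@ler_pXn2r _ 2)// ?nnegrE// real_normK ?num_real// r2.
  by rewrite lerDl sqr_ge0.
have dr : `|d| <= r.
  rewrite -(@ler_pXn2r _ 2)// ?nnegrE// real_normK ?num_real// r2.
  by rewrite lerDr sqr_ge0.
pose M := s h1 + s h2.
have M0 : 0 < M.
  by case/orP: h_neq0 => /s_gt0 ?; [rewrite ltr_wpDr|rewrite ltr_wpDl].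
have B u v : s (u *: iter n V h1 + v *: iter n V h2) <=
    `|u| * (e * s h1) + `|v| * (e * s h2).
  by apply: (le_trans (s_le _ _ _ _)); rewrite lerD// ler_wpM2l.
have sZ t h : 0 <= t -> t * s h <= s (t *: h).
  rewrite le_eqVlt => /predU1P[<-|t0]; first by rewrite mul0r.
  rewrite -ler_pdivlMl//.
  have := s_le t^-1 0 (t *: h) 0.
  by rewrite scalerA mulVf ?gt_eqF// scale1r scale0r addr0 normr0 mul0r addr0
    gtr0_norm ?invr_gt0.
have r20 : 0 <= r ^+ 2 by exact: sqr_ge0.
have F1 : r ^+ 2 * s h1 <= r * (e * M).
  apply: (le_trans (sZ _ _ r20)).
  have -> : r ^+ 2 *: h1 = c *: iter n V h1 + d *: iter n V h2.
    rewrite E1 E2 !scalerDr !scalerA addrACA -!scalerDl.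
    by rewrite [X in X *: h2](_ : _ = 0) ?scale0r ?addr0 ?r2; [congr (_ *: _)|]; ring.
  apply: (le_trans (B _ _)).
  have e1 : 0 <= e * s h1 by exact: le_trans (He h1).
  have e2 : 0 <= e * s h2 by exact: le_trans (He h2).
  by rewrite /M 2!mulrDr lerD// ler_wpM2r.
have F2 : r ^+ 2 * s h2 <= r * (e * M).
  apply: (le_trans (sZ _ _ r20)).
  have -> : r ^+ 2 *: h2 = (- d) *: iter n V h1 + c *: iter n V h2.
    rewrite E1 E2 !scalerDr !scalerA addrACA -!scalerDl.
    by rewrite [X in X *: h1](_ : _ = 0) ?scale0r ?add0r ?r2; [congr (_ *: _)|]; ring.
  apply: (le_trans (B _ _)); rewrite normrN.
  have e1 : 0 <= e * s h1 by exact: le_trans (He h1).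
  have e2 : 0 <= e * s h2 by exact: le_trans (He h2).
  by rewrite /M 2!mulrDr lerD// ler_wpM2r.
have : r * (r * M) <= r * (2 * e * M) by rewrite /M in F1 F2 *; lra.
move: r0; rewrite le_eqVlt => /predU1P[<- _|r0].
  have : 0 <= e * M.
    rewrite /M mulrDr addr_ge0//; apply: le_trans (He _) => //.
  by rewrite pmulr_lge0// => ?; rewrite mulr_ge0.
by rewrite ler_pM2l// ler_pM2r.
Qed.

(** By [rotation_growth], [exp((rho - w) T n) <= 2 C] for all large [n], although
the left-hand side exceeds [(rho - w) T n]. *)
Lemma no_faster_decay (C rho w T : R) (n0 : nat) :
  Num.sqrt (a ^+ 2 + b ^+ 2) = expR (rho * T) -> 0 < T -> w < rho -> 0 < C ->
  ~ forall n, (n0 <= n)%N -> forall h,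
      s (iter n V h) <= (C * expR (w * n%:R * T)) * s h.
Proof.
move=> rhoE T0 wrho C0 H.
have d0 : 0 < (rho - w) * T by rewrite mulr_gt0// subr_gt0.
pose n := maxn n0 (Num.truncn (2 * C / ((rho - w) * T))).+1.
have := rotation_growth (H n (leq_maxl _ _)).
rewrite rhoE -expRM_natr.
have -> : rho * T * n%:R = (rho - w) * T * n%:R + w * n%:R * T by ring.
rewrite expRD mulrA ler_pM2r ?expR_gt0//.
have : 2 * C < (rho - w) * T * n%:R.
  rewrite [ltRHS]mulrC -ltr_pdivrMr// (lt_le_trans (truncnS_gt _))// ler_nat.
  exact: leq_maxr.
have := expR_ge1Dx ((rho - w) * T * n%:R).
by move: (_ * n%:R) => v; move: (expR v) => u; lra.
Qed.

End RotationGrowth.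

(** * The covariance operators of the system *)

Section Covariance.
Context {R : realType} {X : completeNormedModType R}.
Variable ip : {dot X for idfun}.
Hypothesis hip : hilbert_norm ip.
Variables (U : R -> R -> X -> X) (B : R -> X -> X).
Hypothesis hU : evolution_operator U.
Hypothesis hB : forall t, bounded_linear (B t).
Hypothesis hnondeg : forall t x, Qinf ip U B t x = 0 -> x = 0.

Let bU t r : r <= t -> bounded_linear (U t r).
Proof. by have [H _ _ _] := hU; exact: H. Qed.

Let F t := covariance_integrand ip U B t.

(* [Q(t,-oo)] is an integral of operators of the form [G^* G], [G = B(r)^* U(t,r)^*]. *)
Lemma covariance_integrandE t x y r : r <= t ->
  ip (F t x r) y =
  ip (adjoint ip (B r) (adjoint ip (U t r) x)) (adjoint ip (B r) (adjoint ip (U t r) y)).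
Proof.
move=> rt; rewrite /F /covariance_integrand.
by rewrite (adjointE hip _ _ (bU rt)) (adjointE hip _ _ (hB r)).
Qed.

Lemma covariance_integrand_linear t k x y r : r <= t ->
  F t (k *: x + y) r = k *: F t x r + F t y r.
Proof.
move=> rt; rewrite /F /covariance_integrand.
by rewrite (adjoint_linear hip (bU rt)) (adjoint_linear hip (hB r)) (hB r).1 (bU rt).1.
Qed.

Lemma covariance_integrand_sym t x y r : r <= t -> ip (F t x r) y = ip (F t y r) x.
Proof. by move=> rt; rewrite !covariance_integrandE// ipC. Qed.

Lemma covariance_integrand_ge0 t x r : r <= t -> 0 <= ip (F t x r) x.
Proof. by move=> rt; rewrite covariance_integrandE// -hip sqr_ge0. Qed.

(** If no vector represents the weak integral, [Qinf ip U B t x] is the default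
value [0]; non-degeneracy then forces [x = 0], for which [0] does represent it. *)
Lemma Qinf_is_integral t x : is_integral ip `]-oo, t] (F t x) (Qinf ip U B t x).
Proof.
apply: integral_XP; apply: contrapT => nex.
have x0 : x = 0.
  apply: (hnondeg (t := t)); rewrite /Qinf /integral_X xgetPN// => z Hz.
  by apply: nex; exists z.
apply: nex; exists 0 => y.
have F0 r : r <= t -> ip (F t x r) y = 0.
  move=> rt; have := covariance_integrand_linear (-1) 0 0 rt.
  by rewrite scaler0 addr0 scaleN1r addNr x0 => ->; rewrite ip0l.
split.
  apply: eq_integrable (integrable0 _ _) => // r.
  by rewrite inE /= in_itv/= => /F0 ->.
rewrite ip0l (@eq_Rintegral _ _ _ _ _ (fun=> 0)) ?Rintegral0//.
  by rewrite /Rintegral integral0.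
by move=> r; rewrite inE /= in_itv/= => /F0.
Qed.

Lemma Qinf_positive t : positive_op ip (Qinf ip U B t).
Proof.
apply: (@positive_op_integral_family _ _ _ hip `]-oo, t]%classic (F t)).
- by move=> x y r; rewrite /= in_itv/=; exact: covariance_integrand_sym.
- by move=> x r; rewrite /= in_itv/=; exact: covariance_integrand_ge0.
- exact: Qinf_is_integral.
Qed.

Lemma Qinf_trace_class t :
  (ereal_sup [set trace ip (Qts ip U B t s) | s in [set s | (s <= t)%R]] < +oo)%E ->
  positive_trace_class ip (Qinf ip U B t).
Proof.
move=> Qsup; split; first exact: Qinf_positive.
apply: le_lt_trans Qsup; apply: (@le_trace_half_line _ _ _ hip t (F t)).
- by move=> k x y r; exact: covariance_integrand_linear.
- by move=> x y r; exact: covariance_integrand_sym.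
- by move=> x r; exact: covariance_integrand_ge0.
- exact: Qinf_is_integral.
Qed.

Lemma Qinf_form_neq0 t h : h != 0 -> ip (Qinf ip U B t h) h != 0.
Proof.
move=> h0; apply: contra_neq h0 => q0; apply: (hnondeg (t := t)).
exact: (positive_op_form_eq0 hip (Qinf_positive t) q0).
Qed.

Variables (T : R).
Hypothesis Uper : forall t s x, s <= t -> U (t + T) (s + T) x = U t s x.
Hypothesis Bper : forall t x, B (t + T) x = B t x.

Lemma Qinf_periodic t : Qinf ip U B (t + T) = Qinf ip U B t.
Proof.
apply/funext => x; apply: (ip_injl hip) => z.
apply: (etrans (Qinf_is_integral (t + T) x z).2).
apply: esym; apply: (etrans (Qinf_is_integral t x z).2); apply: esym.
apply: (etrans (Rintegral_shift T _ (Qinf_is_integral (t + T) x z).1)) => //.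
have -> : (fun r : R => r + T) @^-1` `]-oo, t + T]%classic = `]-oo, t]%classic.
  by apply/seteqP; split => r /=; rewrite !in_itv/= lerD2r.
apply: eq_Rintegral => r; rewrite inE /= in_itv/= => rt.
rewrite /F /covariance_integrand.
have -> : U (t + T) (r + T) = U t r by apply/funext => u; exact: Uper.
by have -> : B (r + T) = B r by apply/funext => u; exact: Bper.
Qed.

Lemma evolution_operator_periods n x : 0 <= T -> U (n%:R * T) 0 x = iter n (U T 0) x.
Proof.
have [_ Uc U1 _] := hU; move=> T0.
elim: n x => [|n IH] x; first by rewrite mul0r U1.
rewrite iterSr -IH -natr1 mulrDl mul1r.
have nT : 0 <= n%:R * T by rewrite mulr_ge0.
rewrite (Uc _ T) ?lerDr//.
by rewrite -[X in U _ X (U T 0 x)]add0r Uper.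
Qed.

End Covariance.

Lemma iter_adjoint {R : realType} {X : completeNormedModType R}
    (ip : {dot X for idfun}) (S V : X -> X) n x h :
  (forall x h, ip (S x) h = ip x (V h)) -> ip (iter n S x) h = ip x (iter n V h).
Proof.
move=> SV; elim: n x h => [//|n IH] x h.
by rewrite iterS SV IH -iterSr.
Qed.

(** * Failure of faster decay *)

Theorem theorem39 (R : realType) (X : completeNormedModType R)
    (ip : {dot X for idfun}) (hip : hilbert_norm ip) (hsep : @separable R X)
    (DA : R -> set X) (A : R -> X -> X) (U : R -> R -> X -> X)
    (B : R -> X -> X) (N : X -> (X -> X) -> probability (borel X) R)
    (mu : R -> probability (borel X) R) (p : R)
    (P : R -> R -> (borel X -> R) -> (borel X -> R)) (T w : R)
    (hA : forall t, linear_operator_on (DA t) (A t))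
    (hU : evolution_operator U)
    (hAU : generates DA A U)
    (hOmega : growth_exponents U !=set0)
    (homega0 : growth_bound U < 0)
    (hBlin : forall t, bounded_linear (B t))
    (hBbd : exists K : R, forall t, opnorm (B t) <= K)
    (hBmeas : forall x, measurable_fun [set: R] (fun t => B t x : borel X))
    (hQtr : forall t s, s <= t -> positive_trace_class ip (Qts ip U B t s))
    (hQsup : forall t, (ereal_sup
       [set trace ip (Qts ip U B t s) | s in [set s | (s <= t)%R]] < +oo)%E)
    (hctrl : forall t s, s < t ->
       range (U t s) `<=` range (sqrt_op ip (Qts ip U B t s)))
    (hN : gaussian_notation ip N)
    (hmu : forall t, mu t = N 0 (Qinf ip U B t))
    (hnondeg : forall t x, Qinf ip U B t x = 0 -> x = 0)
    (hp : 1 < p)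
    (hP : forall s t, s < t ->
       is_Lp_extension p (mu s) (mu t) (ou ip N U B s t) (P s t))
    (hT : 0 < T)
    (hper : periodic_system DA A U B T)
    (heig : exists l : R[i],
       [/\ ceigenvalue (adjoint ip (U T 0)) l,
           ComplexField.Normc.normc l = spectral_radius (adjoint ip (U T 0))
         & spectral_radius (adjoint ip (U T 0)) = expR (growth_bound U * T)])
    (hw : w < growth_bound U) :
  (~ exists Nw : nat, forall n : nat, (Nw <= n)%N ->
     (Lp_opnorm p (mu 0%R) (centered p (mu 0%R)) (iter n (P 0%R T))
       <= (expR (w * n%:R * T)%R)%:E)%E) /\
  (~ exists2 C : R, 0 < C &
     forall (s t : R) (f : borel X -> R), s < t -> f \in Lfun (mu t) p%:E ->
       ('N[mu s]_(p%:E)[EFin \o (fun x : borel X =>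
           (P s t f x - \int[mu t]_(y in [set: borel X]) f y)%R)]
        <= (C * expR (w * (t - s)))%R%:E * 'N[mu t]_(p%:E)[EFin \o f])%E).
Proof.
have p1 : 1 <= p := ltW hp.
have [Ulin _ _ _] := hU.
have [_ _ Bper Uper] := hper.
have Qpos t := Qinf_positive hip hU hBlin hnondeg t.
have muG t : is_gaussian ip (mu t) 0 (Qinf ip U B t).
  by rewrite hmu; apply: hN; exact: Qinf_trace_class (hQsup t).
have nuG t s : s <= t -> is_gaussian ip (N 0 (Qts ip U B t s)) 0 (Qts ip U B t s).
  by move=> st; apply: hN; exact: hQtr.
have muper n : mu (n%:R * T) = mu 0.
  elim: n => [|n IH]; first by rewrite mul0r.
  rewrite -IH !hmu -natr1 mulrDl mul1r.
  by rewrite (Qinf_periodic hip hU hBlin hnondeg Uper Bper).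
pose f_ (h : X) (x : borel X) : R := ip x h.
pose V := adjoint ip (U T 0).
have Pf t h k : 0 < t -> (forall x, ip (U t 0 x) h = ip x k) ->
    ae_eq (mu 0) setT (P 0 t (f_ h)) (f_ k).
  move=> t0 hk; have t0' := ltW t0.
  apply: (@Lp_extension_linear_functional _ _ _ hip _ _ (hQtr t 0 t0').1 (nuG _ _ t0')
    _ _ _ _ (U t 0) p (Qpos 0) (muG 0) (Qpos t) (muG t) p1 _ _ _ (hP 0 t t0)) => //.
have fL t h : f_ h \in Lfun (mu t) p%:E by exact: (Lfun_ip hip (Qpos t) (muG t) h p1).
have UV x h : ip (U T 0 x) h = ip x (V h).
  by apply: (adjointE hip); apply: Ulin; exact: ltW.
have mean0 t h : \int[mu t]_(y in [set: borel X]) f_ h y = 0.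
  exact: (gaussian_mean0 hip (Qpos t) (muG t) h).
pose s h := fine ('N[mu 0%R]_(p%:E)[EFin \o f_ h])%E.
have sE h : ('N[mu 0%R]_(p%:E)[EFin \o f_ h] = (s h)%:E)%E.
  by rewrite fineK// ge0_fin_numE ?Lnorm_ge0//; exact: (Lfun_measurable_norm_lty (fL 0 h)).2.
have s_ge0 h : 0 <= s h by rewrite fine_ge0// Lnorm_ge0.
have s_gt0 h : h != 0 -> 0 < s h.
  move=> h0; rewrite -lte_fin -sE.
  have q0 := Qinf_form_neq0 hip hU hBlin hnondeg 0 h0.
  exact: (gaussian_Lnorm_gt0 hip (muG 0) p1 q0).
have fZ c h : f_ (c *: h) = (fun x => c * f_ h x).
  by apply/funext => x; rewrite /f_ ipZr.
have sZ c h : s (c *: h) = `|c| * s h.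
  by apply/EFin_inj; rewrite EFinM -!sE fZ Lnorm_scale.
have s_le c d h k : s (c *: h + d *: k) <= `|c| * s h + `|d| * s k.
  rewrite -!sZ -lee_fin EFinD -!sE.
  have -> : f_ (c *: h + d *: k) = (f_ (c *: h) \+ f_ (d *: k))%R.
    by apply/funext => x; rewrite /f_ /= ipDr.
  by apply: eminkowski; rewrite ?lee_fin//; exact: (Lfun_measurable_norm_lty (fL 0 _)).1.
have Vlin : linear V by apply: (adjoint_linear hip); apply: Ulin; exact: ltW.
have [[a b] [[[h1 h2] h0 Vh] nl rhoE]] := heig.
have [Vh1 Vh2] : V h1 = a *: h1 - b *: h2 /\ V h2 = b *: h1 + a *: h2 by case: Vh.
have hh0 : (h1 != 0) || (h2 != 0).
  rewrite -negb_and; apply: contra_notN h0 => /andP[/eqP-> /eqP->] //.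
have abE : Num.sqrt (a ^+ 2 + b ^+ 2) = expR (growth_bound U * T).
  by rewrite -rhoE -nl.
have decay (C : R) n0 := @no_faster_decay _ _ V s h1 h2 a b Vlin Vh1 Vh2 s_ge0 s_gt0
  s_le hh0 C (growth_bound U) w T n0 abE hT hw.
split.
- move=> [n0 H]; apply: (decay 1 n0 ltr01) => n nn0 h.
  have muT : mu T = mu 0 by rewrite -(muper 1%N) mul1r.
  have PT := hP 0 T hT; rewrite muT in PT.
  have [PL _ _ _] := PT.
  have PfT k : ae_eq (mu 0) setT (P 0 T (f_ k)) (f_ (V k)) by exact: Pf.
  have iterP k m : iter m (P 0 T) (f_ k) \in Lfun (mu 0) p%:E /\
      ae_eq (mu 0) setT (iter m (P 0 T) (f_ k)) (f_ (iter m V k)).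
    elim: m => [|m [IHL IHe]]; first by split; [exact: fL|exact: ae_eq_refl].
    rewrite !iterS; split; first exact: PL.
    exact: ae_eq_trans (Lp_extension_ae_eq p1 PT IHL (fL 0 _) IHe) (PfT _).
  (* Test the operator norm on [<., h>] divided by its norm [s h]. *)
  have [->|hn0] := eqVneq h 0.
    by rewrite -[X in iter n V X](scale0r 0) (iter_linear_mapZ Vlin) sZ normr0
      mul0r mulr_ge0// mul1r expR_ge0.
  have sh := s_gt0 _ hn0.
  pose k := (s h)^-1 *: h.
  have sk : s k = 1 by rewrite sZ gtr0_norm ?invr_gt0// mulVf// gt_eqF.
  have : ('N[mu 0%R]_(p%:E)[EFin \o iter n (P 0%R T) (f_ k)] <= (expR (w * n%:R * T))%:E)%E.
    apply: le_trans (H n nn0); apply: ereal_sup_ubound.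
    exists (f_ k) => //; split; last by rewrite sE sk.
    exists (f_ k); first exact: fL.
    by apply/funext => x; rewrite /centering mean0 subr0.
  have [iterL iter_ae] := iterP k n.
  have [miter _] := Lfun_measurable_norm_lty iterL.
  have [mfV _] := Lfun_measurable_norm_lty (fL 0 (iter n V k)).
  rewrite (Lnorm_ae_eq p1 miter mfV iter_ae).
  rewrite sE lee_fin /k (iter_linear_mapZ Vlin) sZ gtr0_norm ?invr_gt0//.
  by rewrite ler_pdivrMl// mul1r mulrC.
- move=> [C C0 H]; apply: (decay C 1%N C0) => n n1 h.
  have nT : 0 < n%:R * T by rewrite mulr_gt0// ltr0n.
  have := H 0 (n%:R * T) (f_ h) nT (fL _ h).
  rewrite mean0 muper sE.
  (* The norms at the times [0] and [n T] agree by periodicity, so one period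
     of length [n T] plays the role of [n] iterations. *)
  have mPf : measurable_fun setT (P 0 (n%:R * T) (f_ h)).
    have [PL _ _ _] := hP 0 _ nT.
    exact: (Lfun_measurable_norm_lty (PL _ (fL _ h))).1.
  have -> : (fun x : borel X => P 0 (n%:R * T) (f_ h) x - 0) = P 0 (n%:R * T) (f_ h).
    by apply/funext => x; rewrite subr0.
  have E : ae_eq (mu 0) setT (P 0 (n%:R * T) (f_ h)) (f_ (iter n V h)).
    apply: Pf => // x.
    rewrite (evolution_operator_periods hU Uper _ _ (ltW hT)).
    exact: iter_adjoint.
  rewrite (Lnorm_ae_eq p1 mPf (Lfun_measurable_norm_lty (fL 0 _)).1 E) sE -EFinM lee_fin.
  by rewrite subr0 mulrA.
Qed.
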